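(* Let $B=\{B_{i,j}\}_{i,j=0}^{n-1}$ be a real $n\times n$ matrix such that $B_{i,i+1}\neq 0$ and $B_{i,j}=0$ for all $i=0,\dots,n-2$ and all $j>i+1$. Let $S$ be a real $\nu\times\nu$ matrix. Then any $S$-perfect structure $h$ over $B$ is uniquely determined by its first row $h_0$. Moreover, the rows $h_0,\dots,h_{n-1}$ of $h$ satisfy the recursive relation $$h_{i+1}=\Bigl(h_iS-\sum_{j=0}^{i}B_{i,j}h_j\Bigr)/B_{i,i+1},\qquad i=0,\dots,n-2,$$ and $$h_i=h_0\,\Pi_i^{(B)}(S),\qquad i=0,\dots,n-1,$$ where $\Pi_i^{(B)}(x)$ is a polynomial of degree $i$ in $x$ (depending only on $B$ and $i$).
   Context: For real matrices $B$ ($n\times n$), $S$ ($\nu\times\nu$) and $h$ ($n\times\nu$), $h$ is called an $S$-perfect structure over $B$ if $Bh=hS$. Rows and columns of $B$ and rows of $h$ are indexed from $0$; the rows $h_i$ are row vectors of length $\nu$. *)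

(* Defs.v *)
From HB Require Import structures.
From mathcomp Require Import all_boot all_order all_algebra.
From mathcomp Require Import reals.
Set Implicit Arguments.
Unset Strict Implicit.
Unset Printing Implicit Defensive.
Import GRing.Theory.
Local Open Scope ring_scope.

(* [perfect_structure S B h]: h is an S-perfect structure over B. *)
Definition perfect_structure (R : realType) (n nu : nat)
    (S : 'M[R]_nu) (B : 'M[R]_n) (h : 'M[R]_(n, nu)) : Prop :=
  B *m h = h *m S.

(* For i, j : 'I_n, the equation j = i.+1 in nat already forces i <= n - 2, and
   so does i.+1 < j; no separate bound on i is needed. *)
Definition lower_hessenberg_unreduced (R : realType) (n : nat)
    (B : 'M[R]_n) : Prop :=
  (forall i j : 'I_n, j = i.+1 :> nat -> B i j != 0) /\
  (forall i j : 'I_n, (i.+1 < j)%N -> B i j = 0).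

(* Main.v *)
Require Import Defs.
From HB Require Import structures.
From mathcomp Require Import all_boot all_order all_algebra.
From mathcomp Require Import reals.
Set Implicit Arguments.
Unset Strict Implicit.
Unset Printing Implicit Defensive.
Import GRing.Theory.
Local Open Scope ring_scope.

(** Row [i] of [B *m h = h *m S] reads
    [\sum_(j <= i) B i j *: h_j + B i i.+1 *: h_i.+1 = h_i *m S], because [B]
    vanishes beyond its superdiagonal; as the superdiagonal entry is nonzero, the
    equation can be solved for [h_i.+1] ([perfect_structure_row_succ]). If
    the earlier rows are [h_j = h_0 *m p_j(S)], the same recursion carried out
    on polynomials, with multiplication by ['X] in the place of multiplication
    by [S], gives [p_i.+1]. It uses only the entries of [B], so one polynomial
    serves all [S] and [h], and the term [p_i * 'X] dominates and raises the
    degree by exactly one ([hessenberg_row_poly_exists]). Uniqueness is then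
    immediate, since every row is a function of [h_0] and [S]. *)

Section Hessenberg.
Variables (R : realType) (n : nat) (B : 'M[R]_n.+1).
Hypothesis hB : lower_hessenberg_unreduced B.

Lemma perfect_structure_row_succ (nu : nat) (S : 'M[R]_nu)
    (h : 'M[R]_(n.+1, nu)) (i i' : 'I_n.+1) :
  perfect_structure S B h -> i' = i.+1 :> nat ->
  row i' h = (B i i')^-1 *:
    (row i h *m S - \sum_(j < n.+1 | (j <= i)%N) B i j *: row j h).
Proof.
case: hB => Bneq0 Beq0 hS ii'.
have -> : row i h *m S = \sum_j B i j *: row j h.
  rewrite -row_mul -hS row_mul mulmx_sum_row.
  by apply: eq_bigr => j _; rewrite mxE.
rewrite (bigID (fun j : 'I_n.+1 => (j <= i)%N)) /= addrAC subrr add0r.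
rewrite (bigD1 i') /=; last by rewrite ii' ltnn.
rewrite big1 ?addr0 => [|j /andP[ltij neji']].
  by rewrite scalerA mulVf ?scale1r // Bneq0.
rewrite Beq0 ?scale0r // -ii' ltn_neqAle eq_sym neji' ii' /=.
by rewrite ltnNge.
Qed.

(** What the [i]th polynomial must satisfy, uniformly in [S] and [h]: the
    uniformity is what allows the polynomials to be chosen from [B] alone. *)
Definition row_poly_spec (i : 'I_n.+1) (p : {poly R}) : Prop :=
  size p = i.+1 /\
  forall (nu : nat) (S : 'M[R]_nu.+1) (h : 'M[R]_(n.+1, nu.+1)),
    perfect_structure S B h -> row i h = row ord0 h *m horner_mx S p.

(** The recursion for rows transported to polynomials: ['X] stands for right
    multiplication by [S]. *)
Definition row_poly_step (P : 'I_n.+1 -> {poly R}) (i i' : 'I_n.+1) :=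
  (B i i')^-1 *: (P i * 'X - \sum_(j < n.+1 | (j <= i)%N) B i j *: P j).

(** The leading term comes from [P i * 'X] alone: the subtracted combination has
    degree at most [i], and rescaling by a nonzero constant is harmless. *)
Lemma size_row_poly_step (P : 'I_n.+1 -> {poly R}) (i i' : 'I_n.+1) :
  i' = i.+1 :> nat ->
  (forall j : 'I_n.+1, (j <= i)%N -> size (P j) = j.+1) ->
  size (row_poly_step P i i') = i'.+1.
Proof.
case: hB => Bneq0 _ ii' sizeP.
have sizePX : size (P i * 'X) = i.+2.
  by rewrite size_mulX -?size_poly_gt0 sizeP.
rewrite size_scale ?invr_eq0 ?Bneq0 // size_polyDl ?sizePX ?ii' //.
rewrite size_polyN ltnS; apply: (leq_trans (size_sum _ _ _)).
apply/bigmax_leqP => j leji.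
by rewrite (leq_trans (size_scale_leq _ _)) // sizeP.
Qed.

Lemma horner_mx_row_poly_step (P : 'I_n.+1 -> {poly R}) (i i' : 'I_n.+1)
    (nu : nat) (S : 'M[R]_nu.+1) (u : 'rV[R]_nu.+1) :
  u *m horner_mx S (row_poly_step P i i') = (B i i')^-1 *:
    (u *m horner_mx S (P i) *m S
     - \sum_(j < n.+1 | (j <= i)%N) B i j *: (u *m horner_mx S (P j))).
Proof.
rewrite /row_poly_step horner_mxZ -scalemxAr; congr (_ *: _).
rewrite raddfB /= rmorphM /= horner_mx_X mulmxBr -mulmxA; congr (_ - _).
rewrite raddf_sum mulmx_sumr; apply: eq_bigr => j _.
by rewrite /= horner_mxZ -scalemxAr.
Qed.

Lemma hessenberg_row_poly_exists (i : 'I_n.+1) :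
  exists p : {poly R}, row_poly_spec i p.
Proof.
(* The recursion refers to all earlier rows, hence strong induction. *)
have [k] := ubnP (i : nat); elim: k i => // k IHk i ltik.
have [i0|i_gt0] := posnP i.
  have -> : i = ord0 by apply: val_inj.
  exists 1; split=> [|nu S h _]; first by rewrite size_poly1.
  by rewrite rmorph1 mulmx1.
have lt_i1 : (i.-1 < n.+1)%N by rewrite (leq_ltn_trans (leq_pred i)).
pose i1 := Ordinal lt_i1.
have ii1 : i = i1.+1 :> nat by rewrite /= prednK.
(* The bound on [j] is moved under the quantifier so that finite choice yields
   a total family [P], with arbitrary values from [i] on. *)
have /fin_all_exists[P specP] (j : 'I_n.+1) :
    exists p, (j <= i1)%N -> row_poly_spec j p.
  case: (leqP j i1) => [leji|_]; last by exists 0.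
  have [|p pP] := IHk j; last by exists p.
  by rewrite (leq_ltn_trans leji) // -ltnS -ii1.
exists (row_poly_step P i1 i); split=> [|nu S h hS].
  by apply: size_row_poly_step => // j /specP[].
rewrite (perfect_structure_row_succ hS ii1) horner_mx_row_poly_step.
have rowP (j : 'I_n.+1) :
    (j <= i1)%N -> row j h = row ord0 h *m horner_mx S (P j).
  by move=> /specP[_]; apply.
rewrite -rowP //; congr (_ *: (_ - _)).
by apply: eq_bigr => j /rowP ->.
Qed.

End Hessenberg.

Theorem theorem2 (R : realType) (n : nat) (B : 'M[R]_n.+1)
    (hB : lower_hessenberg_unreduced B) :
  (forall (nu : nat) (S : 'M[R]_nu.+1) (h h' : 'M[R]_(n.+1, nu.+1)),
     perfect_structure S B h -> perfect_structure S B h' ->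
     row ord0 h = row ord0 h' -> h = h') /\
  (forall (nu : nat) (S : 'M[R]_nu.+1) (h : 'M[R]_(n.+1, nu.+1)),
     perfect_structure S B h ->
     forall i i' : 'I_n.+1, i' = i.+1 :> nat ->
       row i' h = (B i i')^-1 *:
         (row i h *m S - \sum_(j < n.+1 | (j <= i)%N) B i j *: row j h)) /\
  (exists Pi : 'I_n.+1 -> {poly R},
     (forall i : 'I_n.+1, size (Pi i) = i.+1) /\
     (forall (nu : nat) (S : 'M[R]_nu.+1) (h : 'M[R]_(n.+1, nu.+1)),
        perfect_structure S B h ->
        forall i : 'I_n.+1, row i h = row ord0 h *m horner_mx S (Pi i))).
Proof.
have /fin_all_exists[Pi specPi] := hessenberg_row_poly_exists hB.
split; last split.
- move=> nu S h h' hS h'S eq0; apply/row_matrixP => i.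
  by have [_ rowPi] := specPi i; rewrite (rowPi _ _ _ hS) (rowPi _ _ _ h'S) eq0.
- by move=> nu S h hS i i'; apply: perfect_structure_row_succ.
exists Pi; split=> [i|nu S h hS i]; have [sizePi rowPi] := specPi i => //.
exact: rowPi.
Qed.
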